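(* Let $T>0$, $0<\alpha<1$, $0\le\beta\le1$, $\gamma=\alpha+\beta-\alpha\beta$, $\zeta=1-\gamma+\alpha$, $d\in\mathbb{N}$, $\tilde{\mathbf{x}}_0\in\mathbb{R}^d$, $D\subseteq\mathbb{R}^d$ closed and bounded, and $\mathbf{f}:(0,T]\times\mathbb{R}^d\to\mathbb{R}^d$. With the notation of the context, assume: (A.1) $\tilde{\mathbf{x}}_0/\Gamma(\gamma)\in D$ and $\{\mathbf{u}\in C_{1-\gamma}[0,T]:\|\mathbf{u}-\tilde{\mathbf{x}}_0t^{\gamma-1}/\Gamma(\gamma)\|_{C_{1-\gamma}[0,T]}\le\Xi\,\mathbf{m}\}\subseteq X_D[0,T]$, where $\mathbf{m}$ is the vector in (A.2); (A.2) for every $\mathbf{u}\in X_D[0,T]$ the function $t\mapsto\mathbf{f}(t,\mathbf{u}(t))$ is in $C_{1-\gamma}[0,T]$, there is a nonnegative $\mathbf{m}\in\mathbb{R}^d$ with $\|\mathbf{f}(\cdot,\mathbf{u}(\cdot))\|_{C_{1-\gamma}[0,T]}\le\mathbf{m}$ for all $\mathbf{u}\in X_D[0,T]$, and there is $K\in\mathbb{R}^{d\times d}_{\ge0}$ with $|\mathbf{f}(t,\mathbf{u}(t))-\mathbf{f}(t,\mathbf{v}(t))|\le K|\mathbf{u}(t)-\mathbf{v}(t)|$ for all $t\in(0,T]$, $\mathbf{u},\mathbf{v}\in X_D[0,T]$; (A.3) $\rho(\Xi K)<1$, where $\rho$ is the spectral radius. Let $\mathbf{x}(\cdot,\tilde{\mathbf{x}}_0)$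 be the limit in $C_{1-\gamma}[0,T]$ of the sequence $$\mathbf{x}_0(t,\tilde{\mathbf{x}}_0)=\frac{\tilde{\mathbf{x}}_0}{\Gamma(\gamma)}t^{\gamma-1},\qquad \mathbf{x}_{m+1}(t,\tilde{\mathbf{x}}_0)=\mathbf{x}_0(t,\tilde{\mathbf{x}}_0)+\mathcal{T}\{\mathbf{f}(\cdot,\mathbf{x}_m(\cdot,\tilde{\mathbf{x}}_0))\}(t),$$ and put $$\Delta_T(\tilde{\mathbf{x}}_0):=-\Gamma(\zeta+1)T^{-\zeta}\,{}_0I_T^{\zeta}\mathbf{f}(T,\mathbf{x}(T,\tilde{\mathbf{x}}_0)).$$ Suppose $\mathbf{x}(\cdot,\tilde{\mathbf{x}}_0)$ is a solution of the perturbed initial value problem $${}_0D_t^{\alpha,\beta}\mathbf{x}(t)=\mathbf{f}(t,\mathbf{x}(t))+\nu\quad(0<t<T),\qquad{}_0I_0^{1-\gamma}\mathbf{x}(0)=\tilde{\mathbf{x}}_0,\qquad\text{with }\nu=\Delta_T(\tilde{\mathbf{x}}_0).$$ Then $\mathbf{x}(\cdot,\tilde{\mathbf{x}}_0)$ is a solution of the boundary value problem $${}_0D_t^{\alpha,\beta}\mathbf{x}(t)=\mathbf{f}(t,\mathbf{x}(t))\quad(0<t<T),\qquad{}_0I_0^{1-\gamma}\mathbf{x}(0)={}_0I_T^{1-\gamma}\mathbf{x}(T)$$ if and only if $\tilde{\mathbf{x}}_0$ is a solution of $\Delta_T(\tilde{\mathbf{x}}_0)=\mathbf{0}$.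
   Context: Operations ${}_aI_b^{\alpha}$, ${}_0D_t^{\alpha,\beta}$, $|\cdot|$, $\|\cdot\|$ and $\le$ are applied component-wise to vector-valued functions, and membership of a vector-valued function in a function space is component-wise. Riemann-Liouville integral: for $\alpha>0$, $a\le b\le t$, ${}_aI_b^{\alpha}f(t)=\frac1{\Gamma(\alpha)}\int_a^b(t-s)^{\alpha-1}f(s)\,ds$, and ${}_0I_t^0$ is the identity. ${}_0I_T^{\zeta}\mathbf{f}(T,\mathbf{x}(T))$ means ${}_0I_T^{\zeta}$ applied to $s\mapsto\mathbf{f}(s,\mathbf{x}(s))$ and evaluated at $T$. Convention: ${}_0I_0^{\alpha}f(0):=\lim_{t\downarrow0}{}_0I_t^{\alpha}f(t)$. Hilfer derivative of order $\alpha$ and type $\beta$: ${}_0D_t^{\alpha,\beta}={}_0I_t^{\beta(1-\alpha)}\frac{d}{dt}\,{}_0I_t^{(1-\beta)(1-\alpha)}$. $C_{1-\gamma}[0,T]=\{f:(0,T]\to\mathbb{R}: t^{1-\gamma}f\in C[0,T]\}$ (i.e. $t^{1-\gamma}f(t)$ extends continuously to $[0,T]$), with norm $\|f\|_{C_{1-\gamma}[0,T]}=\sup_{t\in(0,T]}|t^{1-\gamma}f(t)|$. $X_D[0,T]=\{\mathbf{u}:(0,T]\to\mathbb{R}^d,\ \mathbf{u}\in C_{1-\gamma}[0,T]:\ t^{1-\gamma}\mathbf{u}(t)\in D\}$. $\mathcal{T}\{\mathbf{y}\}(t)={}_0I_t^{\alpha}\mathbf{y}(t)-\frac{\Gamma(\zeta+1)t^\alpha}{\Gamma(\alpha+1)T^\zeta}\,{}_0I_T^{\zeta}\mathbf{y}(T)$.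 $\Xi=\sup_{t\in(0,T]}\xi(t)$ where, with $\mathrm{B}_z(a,b)=\int_0^z\vartheta^{a-1}(1-\vartheta)^{b-1}d\vartheta$, $$\xi(t)=\frac{\Gamma(\gamma)t^\alpha}{\Gamma(\gamma+\alpha)}+\frac{(t/T)^{\zeta}T^\alpha}{\Gamma(\alpha+1)}\Big[(1-\gamma-\alpha)\mathrm{B}_{t/T}(\gamma,\zeta)+\zeta\,\mathrm{B}_{1-t/T}(\zeta,\gamma)\Big].$$ Under (A.1)-(A.3) the sequence $(\mathbf{x}_m)$ converges in $C_{1-\gamma}[0,T]$, so its limit is well defined. *)

(* Defs.v *)
From HB Require Import structures.
From mathcomp Require Import all_boot all_order all_algebra.
From mathcomp Require Import complex.
From mathcomp Require Import all_classical all_reals all_analysis.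
Set Implicit Arguments.
Unset Strict Implicit.
Unset Printing Implicit Defensive.
Import Order.TTheory GRing.Theory Num.Theory.
Import numFieldNormedType.Exports.
Local Open Scope classical_set_scope.
Local Open Scope ring_scope.

Section SpecialFunctions.
Context {R : realType}.
Implicit Types a b z : R.

Definition Gamma a : R :=
  \int[lebesgue_measure]_(s in `]0, +oo[) (s `^ (a - 1) * expR (- s)).

Definition incBeta z a b : R :=
  \int[lebesgue_measure]_(s in `]0, z[) (s `^ (a - 1) * (1 - s) `^ (b - 1)).

End SpecialFunctions.

Section FractionalCalculus.
Context {R : realType}.
Implicit Types (a b t T alpha beta gamma : R) (f : R -> R).

(* Order 0 is the identity, which is meant only for b = t. *)
Definition RLint a b alpha f t : R :=
  if alpha == 0 then f t
  else (Gamma alpha)^-1 *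
       \int[lebesgue_measure]_(s in `]a, b[) ((t - s) `^ (alpha - 1) * f s).

Definition RL0 alpha f t : R := RLint 0 t alpha f t.

Definition hilfer alpha beta f t : R :=
  RL0 (beta * (1 - alpha)) (derive1 (RL0 ((1 - beta) * (1 - alpha)) f)) t.

(* [derive1] and the integral are total, so the existence of both ingredients of
   [hilfer alpha beta f] on (0, T) has to be stated separately. *)
Definition hilfer_exists alpha beta f T : Prop :=
  let g := RL0 ((1 - beta) * (1 - alpha)) f in
  (forall t, 0 < t < T -> derivable g t 1) /\
  (beta * (1 - alpha) != 0 -> forall t, 0 < t < T ->
     lebesgue_measure.-integrable `]0, t[
       (fun s => ((t - s) `^ (beta * (1 - alpha) - 1) * derive1 g s)%:E)).

(* Elements of the space are functions on (0, T]; they are represented by total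
   functions, whose values outside (0, T] never matter. *)
Definition wC gamma T f : Prop :=
  exists g : R -> R, {within `[0, T], continuous g} /\
    forall t, 0 < t <= T -> g t = t `^ (1 - gamma) * f t.

Definition wCnorm gamma T f : R :=
  sup [set `|t `^ (1 - gamma) * f t| | t in `]0, T]].

End FractionalCalculus.

Section VectorValued.
Context {R : realType} {d : nat}.
Implicit Types (t T alpha beta gamma : R) (u v x : R -> 'cV[R]_d).

Definition mx_le m n (A B : 'M[R]_(m, n)) : Prop :=
  forall i j, A i j <= B i j.

Definition mx_abs m n (A : 'M[R]_(m, n)) : 'M[R]_(m, n) :=
  map_mx Num.norm A.

Definition vcomp u (i : 'I_d) : R -> R := fun t => u t i 0.

Definition vRL0 alpha u t : 'cV[R]_d := \col_i RL0 alpha (vcomp u i) t.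

Definition vhilfer alpha beta u t : 'cV[R]_d :=
  \col_i hilfer alpha beta (vcomp u i) t.

Definition vhilfer_exists alpha beta u T : Prop :=
  forall i, hilfer_exists alpha beta (vcomp u i) T.

Definition vwC gamma T u : Prop := forall i, wC gamma T (vcomp u i).

Definition vwCnorm gamma T u : 'cV[R]_d :=
  \col_i wCnorm gamma T (vcomp u i).

Definition cvg_wC gamma T (u : nat -> R -> 'cV[R]_d) x : Prop :=
  [/\ forall m, vwC gamma T (u m), vwC gamma T x &
      forall i, wCnorm gamma T (vcomp (u m \- x) i) @[m --> \oo] --> (0 : R)].

Definition X_ gamma T (D : set 'cV[R]_d) : set (R -> 'cV[R]_d) :=
  [set u | vwC gamma T u /\
           forall t, 0 < t <= T -> D (t `^ (1 - gamma) *: u t)].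

(* The eigenvalues of the real matrix A are taken in C = R[i]. *)
Definition spectral_radius (A : 'M[R]_d) : R :=
  sup [set ComplexField.Normc.normc l | l in
        [set l : R[i] | eigenvalue (map_mx (real_complex R) A) l]].

End VectorValued.

Section HilferBVP.
Context {R : realType}.
Variables (alpha beta T : R).

Definition hgamma : R := alpha + beta - alpha * beta.
Definition hzeta : R := 1 - hgamma + alpha.

Definition xi (t : R) : R :=
  Gamma hgamma * t `^ alpha / Gamma (hgamma + alpha) +
  (t / T) `^ hzeta * T `^ alpha / Gamma (alpha + 1) *
    ((1 - hgamma - alpha) * incBeta (t / T) hgamma hzeta +
     hzeta * incBeta (1 - t / T) hzeta hgamma).

Definition Xi : R := sup [set xi t | t in `]0, T]].

Context {d : nat}.
Variable f : R -> 'cV[R]_d -> 'cV[R]_d.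
Implicit Types (x y : R -> 'cV[R]_d) (nu : 'cV[R]_d).

Definition Top y (t : R) : 'cV[R]_d :=
  vRL0 alpha y t -
  (Gamma (hzeta + 1) * t `^ alpha / (Gamma (alpha + 1) * T `^ hzeta)) *:
    vRL0 hzeta y T.

Definition xinit (x0 : 'cV[R]_d) (t : R) : 'cV[R]_d :=
  (t `^ (hgamma - 1) / Gamma hgamma) *: x0.

Fixpoint xseq (x0 : 'cV[R]_d) (m : nat) : R -> 'cV[R]_d :=
  if m is m'.+1
  then fun t => xinit x0 t + Top (fun s => f s (xseq x0 m' s)) t
  else xinit x0.

(* Delta_T(x0), where x stands for the limit x(., x0) of [xseq x0]. *)
Definition Delta x : 'cV[R]_d :=
  - ((Gamma (hzeta + 1) * T `^ (- hzeta)) *: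
       vRL0 hzeta (fun s => f s (x s)) T).

Definition solves_eq nu x : Prop :=
  [/\ vwC hgamma T x, vhilfer_exists alpha beta x T &
      forall t, 0 < t < T -> vhilfer alpha beta x t = f t (x t) + nu].

(* The value of I^(1-gamma) x at 0 is its right limit there. *)
Definition RL0_at0 x (c : 'cV[R]_d) : Prop :=
  forall i, RL0 (1 - hgamma) (vcomp x i) t @[t --> 0^'+] --> c i 0.

Definition solves_ivp nu (x0 : 'cV[R]_d) x : Prop := solves_eq nu x /\ RL0_at0 x x0.

Definition solves_bvp x : Prop :=
  solves_eq 0 x /\ RL0_at0 x (vRL0 (1 - hgamma) x T).

End HilferBVP.

(* Main.v *)
(* If Delta_T(x0) = 0, the correction term of the operator T{.} vanishes on
   F := f(., x), so the limit x satisfies x = xinit + I^alpha F on (0, T].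
   Applying I^(1 - gamma) at T and the semigroup law
   I^(1 - gamma) I^alpha = I^zeta gives I^(1 - gamma) x(T) = x0 + I^zeta F(T) = x0,
   while x0 is also the right limit of I^(1 - gamma) x at 0. Conversely, the two
   differential equations, compared at one point of (0, T), force Delta_T(x0) = 0.

   The fixed point equation is obtained by letting m tend to infinity in the
   recursion, which needs the iterates to stay in X_D: this follows from
   t^(1 - gamma) |T{y}(t)| <= xi(t) |y|. That bound and the semigroup law rest on
   Gamma(a) Gamma(b) = B(a, b) Gamma(a + b), proved by Tonelli's theorem. *)

Require Import Defs.
From HB Require Import structures.
From mathcomp Require Import all_boot all_order all_algebra.
From mathcomp Require Import all_classical all_reals all_analysis.
From mathcomp Require Import measurable_realfun ring lra.
Set Implicit Arguments.
Unset Strict Implicit.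
Unset Printing Implicit Defensive.
Import Order.TTheory GRing.Theory Num.Theory.
Import numFieldNormedType.Exports.
Local Open Scope classical_set_scope.
Local Open Scope ring_scope.

(** * Power kernels on the whole line and affine changes of variable *)

Section Kernel.
Context {R : realType}.
Local Notation mu := (@lebesgue_measure R).
Implicit Types a b c h s t x : R.

(* Vanishing on [x <= 0], so that integrals over [`]0, t[] of the power kernels
   are convolutions over the whole line. *)
Definition powk a x : R := (0 < x)%R%:R * x `^ (a - 1).

Lemma powk_ge0 a x : 0 <= powk a x.
Proof. by rewrite /powk mulr_ge0// powR_ge0. Qed.

Lemma powkE a x : 0 < x -> powk a x = x `^ (a - 1).
Proof. by move=> x0; rewrite /powk x0 mul1r. Qed.

Lemma powk_le0 a x : x <= 0 -> powk a x = 0.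
Proof. by move=> x0; rewrite /powk ltNge x0 mul0r. Qed.

Lemma powk1 x : powk 1 x = (0 < x)%R%:R.
Proof. by rewrite /powk subrr powRr0 mulr1. Qed.

Lemma powkZ a c x : 0 < c -> powk a (c * x) = c `^ (a - 1) * powk a x.
Proof.
move=> c0; rewrite /powk pmulr_rgt0//; case: (ltP 0 x) => x0; last by rewrite !mul0r mulr0.
by rewrite !mul1r powRM// ltW.
Qed.

Lemma measurable_powk a : measurable_fun setT (powk a).
Proof.
have -> : powk a = (fun x => \1_`]0, +oo[%classic x * x `^ (a - 1)).
  by apply/funext => x; rewrite /powk indicE mem_setE/= in_itv/= andbT.
apply: measurable_funM; last exact: measurable_powR.
exact: measurable_indic.
Qed.

(** Scaled by [|c|], the pushforward of Lebesgue measure along [x |-> c * x + h] gives every []a,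
    b]] its length, so it is Lebesgue measure by uniqueness. Negative [c] is included because a
    reflection is used later, and the integrals may be infinite. *)
Lemma ge0_integral_affine c h (f : R -> \bar R) : c != 0 ->
  measurable_fun setT f -> (forall x, (0 <= f x)%E) ->
  (\int[mu]_x f x = `|c|%:E * \int[mu]_x f (c * x + h)%R)%E.
Proof.
move=> c0 mf f0; pose phi : measurableTypeR R -> measurableTypeR R := fun x => c * x + h.
have mphi : measurable_fun setT phi.
  by apply: measurable_funD => //; exact: mulrl_measurable.
have c1 : 0 < `|c| by rewrite normr_gt0.
pose k := NngNum (ltW c1).
pose m1 := measure_function_pushforward__canonical__measure_function_Measure mu mphi.
have E : forall A, measurable A -> mu A = mscale k m1 A.
  apply: lebesgue_measure_unique => _ [[a b]] _ <-.
  change (mu `]a, b] = (`|c|%:E * mu (phi @^-1` `]a, b]))%E).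
  have [cp|cn] := ltP 0 c.
    rewrite (_ : _ @^-1` _ = `](a - h) / c, (b - h) / c]%classic); last first.
      apply/seteqP; split => x; rewrite /phi/= !in_itv/=;
      by rewrite ltr_pdivrMr// ler_pdivlMr// ltrBlDr lerBrDr mulrC.
    rewrite !lebesgue_measure_itv/= !lte_fin ltr_pM2r ?invr_gt0// ltrD2r.
    case: ifP => _; last by rewrite mule0.
    by rewrite -!EFinB -EFinM; congr EFin; rewrite (gtr0_norm cp); field.
  (* For negative [c] the preimage of []a, b]] is closed on the left and open on the right, with the
     same length as before. *)
  have cn' : c < 0 by rewrite lt_neqAle c0.
  rewrite (_ : _ @^-1` _ = `[(b - h) / c, (a - h) / c[%classic); last first.
    apply/seteqP; split => x; rewrite /phi/= !in_itv/=;
    by rewrite ltr_ndivlMr// ler_ndivrMr// ltrBlDr lerBrDr mulrC andbC.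
  rewrite !lebesgue_measure_itv/= !lte_fin ltr_nM2r ?invr_lt0// ltrD2r.
  case: ifP => _; last by rewrite mule0.
  by rewrite -!EFinB -EFinM; congr EFin; rewrite (ltr0_norm cn'); field.
rewrite (eq_measure_integral (mscale k m1)); last by move=> A mA _; exact: E.
rewrite ge0_integral_mscale//=.
by rewrite ge0_integral_pushforward.
Qed.
End Kernel.

(** * Euler's integrals and the Gamma-Beta relation in the extended reals *)

Section EulerIntegrals.
Context {R : realType}.
Local Notation mu := (@lebesgue_measure R).
Implicit Types a b c h s t x : R.

Lemma measurable_powkB a t : measurable_fun setT (fun s => powk a (t - s)).
Proof.
apply: (measurableT_comp (measurable_powk a)) => //.
exact: measurable_funB.
Qed.

(** Extended-real values let Tonelli's theorem apply before any finiteness is known. *)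
Definition eGamma a : \bar R := (\int[mu]_x (powk a x * expR (- x))%:E)%E.
Definition eBeta a b : \bar R := (\int[mu]_s (powk a (1 - s) * powk b s)%:E)%E.

Lemma eGamma_ge0 a : (0 <= eGamma a)%E.
Proof. by apply: integral_ge0 => x _; rewrite lee_fin mulr_ge0// ?powk_ge0 ?expR_ge0. Qed.

Lemma eBeta_ge0 a b : (0 <= eBeta a b)%E.
Proof. by apply: integral_ge0 => x _; rewrite lee_fin mulr_ge0// powk_ge0. Qed.

Lemma measurable_powk_exp a : measurable_fun setT (fun x => (powk a x * expR (- x))%:E).
Proof.
apply/measurable_EFinP.
apply: measurable_funM; first exact: measurable_powk.
exact: measurableT_comp.
Qed.

Lemma measurable_powkM a b t : measurable_fun setT (fun s => (powk a (t - s) * powk b s)%:E).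
Proof.
apply/measurable_EFinP/measurable_funM; last exact: measurable_powk.
exact: measurable_powkB.
Qed.

(** For [t > 0] the substitution [s -> t * s] extracts the powers of [t]. For [t <= 0] the two
    kernels have disjoint supports. *)
Lemma powk_conv a b t :
  (\int[mu]_s (powk a (t - s) * powk b s)%:E = (powk (a + b) t)%:E * eBeta a b)%E.
Proof.
have [t0|t0] := leP t 0.
  rewrite powk_le0// mul0e integral0_eq// => s _.
  have [s0|s0] := leP s 0; first by rewrite (powk_le0 b)// mulr0.
  by rewrite (powk_le0 a) ?mul0r// subr_le0 (le_trans t0)// ltW.
rewrite (ge0_integral_affine 0 (lt0r_neq0 t0)); last first.
- by move=> x; rewrite lee_fin mulr_ge0// powk_ge0.
- exact: measurable_powkM.
under eq_integral => x _.
  rewrite addr0 -[X in _ (X - _)]mulr1 -mulrBr !powkZ// mulrACA EFinM.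
  over.
rewrite ge0_integralZl//=; last 3 first.
- exact: measurable_powkM.
- by move=> x _; rewrite lee_fin mulr_ge0// powk_ge0.
- by rewrite lee_fin mulr_ge0// powR_ge0.
rewrite muleA -EFinM gtr0_norm// powkE//; congr (_%:E * _)%E.
have -> : a + b - 1 = 1 + ((a - 1) + (b - 1)) by ring.
by rewrite (@powRD _ t 1) ?(@powRD _ t (a - 1)) ?(gt_eqF t0) ?implybT// powRr1 ?ltW.
Qed.

(** The function [F] is integrated over the plane in both orders. With the second variable inside,
    the convolution [powk_conv] produces [eBeta a b]. With the first one inside, a shift by [y]
    factors the exponential and the integrals separate. *)
Lemma eGammaM a b : (eGamma a * eGamma b = eBeta a b * eGamma (a + b))%E.
Proof.
pose F (z : R * R) := (powk a (z.1 - z.2) * powk b z.2 * expR (- z.1))%:E.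
have mF : measurable_fun setT F.
  apply/measurable_EFinP/measurable_funM; last first.
    by apply: measurableT_comp => //; exact: measurableT_comp.
  apply: measurable_funM.
    apply: (measurableT_comp (measurable_powk a)).
    by apply: measurable_funB.
  exact: (measurableT_comp (measurable_powk b)).
have F0 z : (0 <= F z)%E.
  by rewrite lee_fin mulr_ge0 ?expR_ge0// mulr_ge0 ?powk_ge0.
have := @fubini_tonelli _ _ _ _ _ mu mu F mF F0.
have L : (\int[mu]_x \int[mu]_y F (x, y) = eBeta a b * eGamma (a + b))%E.
  rewrite /eGamma -ge0_integralZl//=; last 3 first.
  - exact: measurable_powk_exp.
  - by move=> x _; rewrite lee_fin mulr_ge0 ?expR_ge0 ?powk_ge0.
  - exact: eBeta_ge0.
  apply: eq_integral => x _; rewrite /F/=.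
  under eq_integral do rewrite mulrC EFinM.
  rewrite ge0_integralZl//=; last 2 first.
  - exact: measurable_powkM.
  - by move=> y _; rewrite lee_fin mulr_ge0// powk_ge0.
  by rewrite powk_conv muleA muleC -EFinM mulrC.
rewrite {}L => ->.
rewrite {2}/eGamma -ge0_integralZl//=; last 3 first.
- exact: measurable_powk_exp.
- by move=> x _; rewrite lee_fin mulr_ge0 ?expR_ge0 ?powk_ge0.
- exact: eGamma_ge0.
apply: eq_integral => y _; rewrite /F/=.
rewrite (@ge0_integral_affine R 1 y)//; last first.
- by move=> x; rewrite lee_fin mulr_ge0 ?expR_ge0// mulr_ge0 ?powk_ge0.
- apply/measurable_EFinP/measurable_funM; last exact: measurableT_comp.
  apply: measurable_funM => //.
  apply: (measurableT_comp (measurable_powk a)) => //.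
  exact: measurable_funB.
rewrite normr1 mul1e muleC.
rewrite /eGamma -ge0_integralZl//=; last 3 first.
- exact: measurable_powk_exp.
- by move=> x _; rewrite lee_fin mulr_ge0 ?expR_ge0 ?powk_ge0.
- by rewrite lee_fin mulr_ge0 ?expR_ge0 ?powk_ge0.
apply: eq_integral => x _; rewrite -EFinM; congr EFin.
by rewrite mul1r addrK opprD expRD; ring.
Qed.
End EulerIntegrals.

(** * Finiteness, positivity and recurrence of Gamma, and the value of Beta *)

Section GammaFunction.
Context {R : realType}.
Local Notation mu := (@lebesgue_measure R).
Implicit Types a b c h s t x : R.

(** The integrand may be singular at 0, so the fundamental theorem of calculus is applied on
    [[u n, 1]] and monotone convergence lets [u n] tend to 0. *)
Lemma integral_powR01 a : 0 < a ->
  (\int[mu]_(s in `]0%R, 1%R]) (s `^ (a - 1))%:E = (a^-1)%:E)%E.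
Proof.
move=> a0; pose u n : R := n.+2%:R^-1.
have u0 n : 0 < u n by rewrite invr_gt0.
have u1 n : u n < 1 by rewrite invf_lt1// ltr1n.
have uE : `]0, 1]%classic = \bigcup_n `[u n, 1]%classic.
  apply/seteqP; split => x /=.
    rewrite in_itv/= => /andP[x0 x1].
    exists (Num.truncn x^-1) => //=; rewrite in_itv/= x1 andbT /u.
    rewrite -[leRHS]invrK lef_pV2 ?posrE ?invr_gt0//.
    have := truncnS_gt x^-1; lra.
  by move=> [n _]; rewrite /= !in_itv/= => /andP[ux ->]; rewrite (lt_le_trans (u0 n) ux).
have cu : u n @[n --> \oo] --> 0.
  by have := @cvg_harmonic R; rewrite -cvg_shiftS.
have cua : (a^-1 - u n `^ a / a) @[n --> \oo] --> a^-1.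
  rewrite -[X in _ --> X]subr0; apply: cvgB; first exact: cvg_cst.
  rewrite -[X in _ --> X](mul0r a^-1); apply: cvgM; last exact: cvg_cst.
  have /cvg_at_rightP := @powR_cvg0 R a a0.
  exact.
have -> : (\int[mu]_(s in `]0%R, 1%R]) (s `^ (a - 1))%:E =
   limn (fun n => \int[mu]_(s in `[u n, 1%R]) (s `^ (a - 1))%:E))%E.
  rewrite uE; apply/esym/cvg_lim => //.
  apply: ge0_nondecreasing_set_cvg_integral => //.
  - move=> m n mn; apply/subsetPset => x /=; rewrite !in_itv/= => /andP[ux ->].
    rewrite andbT (le_trans _ ux)// /u lef_pV2 ?posrE// ler_nat.
    by rewrite !ltnS.
  - move=> n; apply/measurable_EFinP; apply: measurable_funTS.
    exact: measurable_powR.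
  - by move=> n x _; rewrite lee_fin powR_ge0.
apply/cvg_lim => //.
have E n : (\int[mu]_(s in `[u n, 1%R]) (s `^ (a - 1))%:E = (a^-1 - u n `^ a / a)%:E)%E.
  rewrite (@continuous_FTC2 _ (fun s => s `^ (a - 1)) (fun s => s `^ a / a))//.
  - by rewrite powR1 mul1r.
  - apply: derivable_within_continuous => x; rewrite in_itv/= => /andP[ux _].
    by apply: derivable_powR; rewrite in_itv/= andbT (lt_le_trans (u0 n)).
  - have D x : 0 < x -> derivable (fun s => s `^ a / a) x 1.
      by move=> x0; apply: derivableM => //; apply: derivable_powR; rewrite in_itv/= andbT.
    have C x : 0 < x -> {for x, continuous (fun s => s `^ a / a)}.
      by move=> x0; apply: differentiable_continuous; apply/derivable1_diffP; exact: D.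
    split.
    + by move=> x; rewrite in_itv/= => /andP[ux _]; apply: D; rewrite (lt_trans (u0 n)).
    + by apply: cvg_at_right_filter; exact: C.
    + by apply: cvg_at_left_filter; exact: C.
  - move=> x; rewrite in_itv/= => /andP[ux _].
    have x0 := lt_trans (u0 n) ux.
    rewrite derive1E deriveM//; last by apply: derivable_powR; rewrite in_itv/= andbT.
    rewrite derive_cst scaler0 add0r -derive1E powR_derive1 ?in_itv/= ?andbT//.
    by rewrite /GRing.scale/= mulrA mulVf ?mul1r// gt_eqF.
under eq_fun do rewrite E.
by apply: cvg_EFin => //; exact: nearW.
Qed.

Lemma eBeta1l a : 0 < a -> eBeta 1 a = (a^-1)%:E.
Proof.
move=> a0; rewrite -integral_powR01// -integral_itv_bndo_bndc; last first.
  by apply/measurable_EFinP; apply: measurable_funTS; exact: measurable_powR.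
rewrite [RHS]integral_mkcond; apply: eq_integral => s _; rewrite patchE mem_setE in_itv/=.
rewrite powk1 subr_gt0 /powk; case: (0 < s); case: (s < 1) => /=;
 by rewrite ?(mul0r, mul1r, mulr0).
Qed.

Lemma Gamma_fine a : Gamma a = fine (eGamma a).
Proof.
rewrite /Gamma /Rintegral integral_mkcond; congr fine; apply: eq_integral => s _.
rewrite patchE mem_setE in_itv/= andbT /powk.
by case: ifP => //; rewrite ?mul1r ?mul0r.
Qed.

Lemma eGamma1 : eGamma (1 : R) = 1%E.
Proof.
rewrite -(@integral_exponential_pdf R 1)//.
have -> : eGamma (1 : R) = (\int[mu]_(x in `]0%R, +oo[) (expR (- x))%:E)%E.
  rewrite [RHS]integral_mkcond; apply: eq_integral => s _.
  rewrite patchE mem_setE in_itv/= andbT powk1.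
  by case: ifP => //; rewrite ?mul1r ?mul0r.
rewrite integral_itv_obnd_cbnd; last first.
  apply/measurable_EFinP; apply: measurable_funTS; exact: measurableT_comp.
rewrite integral_mkcond; apply: eq_integral => s _.
rewrite /exponential_pdf !patchE; case: ifP => //.
by rewrite mul1r mulN1r.
Qed.

(** This is the case of [eGammaM] with first argument 1, where [eGamma 1 = 1] and
    [eBeta 1 a = 1 / a]; integration by parts is avoided. *)
Lemma eGammaS a : 0 < a -> eGamma (a + 1) = (a%:E * eGamma a)%E.
Proof.
move=> a0; have := eGammaM 1 a; rewrite eGamma1 mul1e eBeta1l// => ->.
by rewrite muleA -EFinM divff ?gt_eqF// mul1e addrC.
Qed.

(** On [(0, 1)] the exponential is at least [expR (-1)], so [eGamma a] is at least
    [expR (-1) * eBeta 1 a], that is [expR (-1) / a]. *)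
Lemma eGamma_gt0 a : 0 < a -> (0 < eGamma a)%E.
Proof.
move=> a0; apply: (@lt_le_trans _ _ ((expR (-1))%:E * (a^-1)%:E)%E).
  by rewrite -EFinM lte_fin mulr_gt0 ?invr_gt0 ?expR_gt0.
rewrite -eBeta1l// -ge0_integralZl//=; last 2 first.
- exact: measurable_powkM.
- by move=> x _; rewrite lee_fin mulr_ge0// powk_ge0.
apply: ge0_le_integral => //=.
- by move=> x _; rewrite -EFinM lee_fin mulr_ge0 ?expR_ge0// mulr_ge0 ?powk_ge0.
- exact: (measurable_funeM _ (measurable_powkM 1 a 1)).
- exact: measurable_powk_exp.
move=> x _; rewrite -EFinM lee_fin powk1 subr_gt0.
case: (ltP x 1) => x1; last by rewrite mul0r mulr0 mulr_ge0 ?powk_ge0 ?expR_ge0.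
by rewrite mul1r mulrC ler_wpM2l ?powk_ge0// ler_expR lerN2 ltW.
Qed.

(** The recurrence gives finiteness at positive integers. For [b >= 1] and [n = truncn b] the bound
    [x]^ (b - 1) <= 1 + x [^ n] on [x > 0] reduces to these. A general [a > 0] is reached from
    [a + 1] by the recurrence again. *)
Lemma eGamma_fin a : 0 < a -> eGamma a \is a fin_num.
Proof.
have G n : eGamma (n.+1%:R : R) \is a fin_num.
  elim: n => [|n ih]; first by rewrite eGamma1.
  by rewrite -addn1 natrD eGammaS// fin_numM.
have G1 b : 1 <= b -> eGamma b \is a fin_num.
  move=> b1; rewrite ge0_fin_numE ?eGamma_ge0//.
  pose n := Num.truncn b.
  apply: (@le_lt_trans _ _ (eGamma 1 + eGamma n.+1%:R)%E); last first.
    have := G n; rewrite eGamma1 ge0_fin_numE ?eGamma_ge0// => Gn.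
    by rewrite lte_add_pinfty// ltry.
  rewrite /eGamma -ge0_integralD//=; last 4 first.
  - by move=> x _; rewrite lee_fin mulr_ge0 ?powk_ge0 ?expR_ge0.
  - exact: measurable_powk_exp.
  - by move=> x _; rewrite lee_fin mulr_ge0 ?powk_ge0 ?expR_ge0.
  - exact: measurable_powk_exp.
  apply: ge0_le_integral => //=.
  - by move=> x _; rewrite lee_fin mulr_ge0 ?powk_ge0 ?expR_ge0.
  - exact: measurable_powk_exp.
  - by apply: emeasurable_funD; exact: measurable_powk_exp.
  move=> x _; rewrite -EFinD lee_fin -mulrDl ler_wpM2r ?expR_ge0//.
  have [x0|x0] := leP x 0; first by rewrite !powk_le0// addr0.
  rewrite !powkE// subrr powRr0.
  have [x1|x1] := leP x 1.
    rewrite (@le_trans _ _ 1)// ?lerDl ?powR_ge0//.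
    by rewrite -[leRHS](powRr0 x) ger_powR ?x0// subr_ge0.
  rewrite (@le_trans _ _ (x `^ (n.+1%:R - 1)))// ?lerDr//.
  by apply: ler_powR; [exact: ltW|rewrite lerD2r ltW// truncnS_gt].
move=> a0; have := G1 (a + 1); rewrite lerDr => /(_ (ltW a0)).
rewrite eGammaS// !ge0_fin_numE ?mule_ge0 ?eGamma_ge0// ?lee_fin ?ltW//.
have := eGamma_ge0 a; case: (eGamma a) => [r| |]// _; first by move=> _; exact: ltry.
by rewrite mulry gtr0_sg// mul1e.
Qed.

Lemma eGammaE a : 0 < a -> eGamma a = (Gamma a)%:E.
Proof. by move=> a0; rewrite Gamma_fine fineK// eGamma_fin. Qed.

Lemma Gamma_gt0 a : 0 < a -> 0 < Gamma a.
Proof. by move=> a0; have := eGamma_gt0 a0; rewrite eGammaE. Qed.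

Lemma Gamma1 : Gamma (1 : R) = 1.
Proof. by rewrite Gamma_fine eGamma1. Qed.

Lemma GammaS a : 0 < a -> Gamma (a + 1) = a * Gamma a.
Proof.
move=> a0; apply: EFin_inj; rewrite EFinM -!eGammaE ?eGammaS//.
by rewrite addr_gt0.
Qed.

(** The closed form of Euler's beta function; [eBetaE] identifies it with the integral [eBeta]. *)
Definition Beta a b : R := Gamma a * Gamma b / Gamma (a + b).

Lemma Beta_gt0 a b : 0 < a -> 0 < b -> 0 < Beta a b.
Proof. by move=> a0 b0; rewrite divr_gt0 ?mulr_gt0 ?Gamma_gt0 ?addr_gt0. Qed.

Lemma eBetaE a b : 0 < a -> 0 < b -> eBeta a b = (Beta a b)%:E.
Proof.
move=> a0 b0; have ab0 : 0 < a + b by rewrite addr_gt0.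
have := eGammaM a b; rewrite !eGammaE//.
have := eBeta_ge0 a b; case: (eBeta a b) => [r| |]// _.
  move=> [E]; congr EFin; rewrite /Beta E mulfK// gt_eqF//.
  exact: Gamma_gt0.
(* An infinite [eBeta a b] would make the right side of [eGammaM] infinite, while the left side is
   finite. *)
by rewrite mulyr gtr0_sg ?Gamma_gt0// mul1e.
Qed.
End GammaFunction.

(** * Riemann-Liouville integrals as convolutions, and their semigroup law *)

Section RiemannLiouville.
Context {R : realType}.
Local Notation mu := (@lebesgue_measure R).
Implicit Types (a b c h s t x M : R) (y : R -> R).

(** The bound forces [y] to vanish on [s <= 0]. With [b = gamma] this is the form that elements of
    the weighted space take after restriction to []0, T[]. *)
Definition dominated b M y :=
  measurable_fun setT y /\ forall s, `|y s| <= M * powk b s.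

(** The Riemann-Liouville integral from 0 for such [y]: the lower limit is encoded in [y] and the
    upper one in the kernel, so the domain of integration is fixed, as Fubini's theorem requires. *)
Definition RLk a y t : R :=
  (Gamma a)^-1 * \int[mu]_s (powk a (t - s) * y s).

Lemma ge0_integrable (f : R -> R) : (forall x, 0 <= f x) ->
  measurable_fun setT (fun x => (f x)%:E) -> (\int[mu]_x (f x)%:E < +oo)%E ->
  mu.-integrable setT (fun x => (f x)%:E).
Proof.
move=> f0 mf foo; apply/integrableP; split => //.
by under eq_integral => x _ do rewrite gee0_abs ?lee_fin//.
Qed.

Lemma integrable_powkM a b t : 0 < a -> 0 < b ->
  mu.-integrable setT (EFin \o (fun s => powk a (t - s) * powk b s)).
Proof.
move=> a0 b0; apply: ge0_integrable; last 2 first.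
- exact: measurable_powkM.
- by rewrite powk_conv eBetaE// -EFinM ltry.
by move=> s; rewrite mulr_ge0 ?powk_ge0.
Qed.

Lemma Rintegral_powkM a b t : 0 < a -> 0 < b ->
  \int[mu]_s (powk a (t - s) * powk b s) = Beta a b * powk (a + b) t.
Proof. by move=> a0 b0; rewrite /Rintegral powk_conv eBetaE//= mulrC. Qed.

Lemma integrable_dominated a b M y t : 0 < a -> 0 < b -> dominated b M y ->
  mu.-integrable setT (EFin \o (fun s => powk a (t - s) * y s)).
Proof.
move=> a0 b0 [my yM].
have := integrableZl measurableT M (integrable_powkM t a0 b0).
apply: le_integrable => //=.
- apply/measurable_EFinP/measurable_funM => //; exact: measurable_powkB.
- move=> s _; rewrite lee_fin normrM ger0_norm ?powk_ge0//.
  by rewrite (le_trans _ (ler_norm _))// mulrCA ler_wpM2l ?powk_ge0.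
Qed.

Lemma powk_conv_shift a b t s : 0 < a -> 0 < b ->
  (\int[mu]_r (powk a (t - r) * powk b (r - s))%:E =
   (Beta a b * powk (a + b) (t - s))%:E)%E.
Proof.
move=> a0 b0; rewrite (@ge0_integral_affine R 1 s)//; last 2 first.
- apply/measurable_EFinP/measurable_funM; first exact: measurable_powkB.
  by apply: (measurableT_comp (measurable_powk b)) => //; exact: measurable_funB.
- by move=> x; rewrite lee_fin mulr_ge0// powk_ge0.
rewrite normr1 mul1e mulrC EFinM -eBetaE// -powk_conv.
apply: eq_integral => r _.
by rewrite mul1r addrK opprD addrCA addrC.
Qed.

Lemma integrable_powk_shift a b t s : 0 < a -> 0 < b ->
  mu.-integrable setT (EFin \o (fun r => powk a (t - r) * powk b (r - s))).
Proof.
move=> a0 b0; apply: ge0_integrable.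
- by move=> r; rewrite mulr_ge0 ?powk_ge0.
- apply/measurable_EFinP/measurable_funM; first exact: measurable_powkB.
  by apply: (measurableT_comp (measurable_powk b)) => //; exact: measurable_funB.
- by rewrite powk_conv_shift// ltry.
Qed.

Section Semigroup.
Variables (a b c M t : R) (y : R -> R).
Hypotheses (a0 : 0 < a) (b0 : 0 < b) (c0 : 0 < c) (yM : dominated c M y).

Let F (z : R * R) := (powk a (t - z.1) * powk b (z.1 - z.2) * y z.2)%:E.

Let mF : measurable_fun setT F.
Proof.
have [my _] := yM.
apply/measurable_EFinP/measurable_funM; last exact: measurableT_comp.
apply: measurable_funM.
  by apply: (measurableT_comp (measurable_powkB a t)).
apply: (measurableT_comp (measurable_powk b)).
by apply: measurable_funB.
Qed.

(** By Tonelli it suffices to integrate [|F|] in [r] first. The two kernels convolve to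
    [Beta a b * powk (a + b) (t - s)], and what remains is integrable because [y] is dominated. *)
Let iF : (mu \x mu)%E.-integrable setT F.
Proof.
apply: (integrable21ltyP mu mu mF).2.
have /integrableP[_] := integrable_dominated t (addr_gt0 a0 b0) c0 yM.
set I := (X in (X < _)%E) => Ioo.
have -> : (\int[mu]_s \int[mu]_r `|F (r, s)| = (Beta a b)%:E * I)%E; last first.
  by rewrite lte_mul_pinfty// lee_fin ltW// Beta_gt0.
rewrite /I -ge0_integralZl//=; last 2 first.
- have /integrableP[/measurable_EFinP m _] :=
    integrable_dominated t (addr_gt0 a0 b0) c0 yM.
  by apply/measurable_EFinP; exact: measurableT_comp m.
- by rewrite lee_fin ltW// Beta_gt0.
apply: eq_integral => s _.
rewrite /F/=; under eq_integral => r _.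
  have -> : `|powk a (t - r) * powk b (r - s) * y s| = `|y s| * (powk a (t - r) * powk b (r - s)).
    by rewrite normrM (ger0_norm (mulr_ge0 (powk_ge0 _ _) (powk_ge0 _ _))) mulrC.
  rewrite EFinM; over.
rewrite ge0_integralZl//=; last 2 first.
- have /integrableP[m _] := integrable_powk_shift t s a0 b0; exact: m.
- by move=> r _; rewrite lee_fin mulr_ge0 ?powk_ge0.
rewrite powk_conv_shift// -!EFinM normrM [X in _ = (_ * (X * _))%:E]ger0_norm ?powk_ge0//.
by congr EFin; ring.
Qed.

Let FE1 r : (\int[mu]_s F (r, s) = (powk a (t - r) * (Gamma b * RLk b y r))%:E)%E.
Proof.
have ib := integrable_dominated r b0 c0 yM.
rewrite /F/=; under eq_integral => s _ do rewrite -mulrA EFinM.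
rewrite integralZl// [RHS]EFinM; congr (_ * _)%E.
rewrite /RLk mulVKf ?gt_eqF ?Gamma_gt0// /Rintegral fineK//.
exact: integrable_fin_num.
Qed.

(** Up to the factor [Gamma b], the function is the partial integral of [F] in [s], which is
    integrable by Fubini's theorem. *)
Lemma integrable_RLk : mu.-integrable setT (EFin \o (fun r => powk a (t - r) * RLk b y r)).
Proof.
have /(integrableZl measurableT) := integrable_fubini_F iF.
move/(_ (Gamma b)^-1); apply: eq_integrable => // r _.
rewrite /fubini_F FE1 -EFinM /=; congr EFin.
by rewrite [LHS]mulrCA mulKf// gt_eqF ?Gamma_gt0.
Qed.

(** The two orders of integration of [F] yield the two sides: the inner integral in [s] is [FE1],
    the one in [r] is a Beta convolution whose constant cancels the Gamma factors. *)
Lemma RLk_semigroup : RLk a (RLk b y) t = RLk (a + b) y t.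
Proof.
have := Fubini iF.
under eq_integral => r _ do rewrite FE1.
have -> : (\int[mu]_s \int[mu]_r F (r, s) =
   \int[mu]_s (Beta a b * (powk (a + b) (t - s) * y s))%:E)%E.
  apply: eq_integral => s _; rewrite /F/=.
  under eq_integral => r _ do rewrite mulrC EFinM.
  rewrite integralZl//; last exact: integrable_powk_shift.
  by rewrite powk_conv_shift// -EFinM; congr EFin; ring.
move=> E; have {}E : \int[mu]_r (powk a (t - r) * (Gamma b * RLk b y r)) =
   \int[mu]_s (Beta a b * (powk (a + b) (t - s) * y s)) by rewrite /Rintegral E.
move: E; under eq_Rintegral => r _ do rewrite mulrCA.
rewrite !RintegralZl//; last 2 first.
- exact: integrable_RLk.
- exact: (integrable_dominated t (addr_gt0 a0 b0) c0 yM).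
move=> E; rewrite /RLk -/(RLk b y).
apply: (@mulfI _ (Gamma b)); first by rewrite gt_eqF ?Gamma_gt0.
rewrite mulrCA E /Beta; field.
by rewrite !gt_eqF ?Gamma_gt0// ?addr_gt0.
Qed.
End Semigroup.

Lemma RLk_le0 a b M y t : 0 < a -> t <= 0 -> dominated b M y -> RLk a y t = 0.
Proof.
move=> a0 t0 [_ yM]; rewrite /RLk (_ : \int[mu]_s _ = 0) ?mulr0//.
rewrite /Rintegral integral0_eq// => s _.
have [s0|s0] := leP s 0; last first.
  by rewrite powk_le0 ?mul0r// subr_le0 (le_trans t0)// ltW.
have := yM s; rewrite (powk_le0 b)// mulr0 normr_le0 => /eqP ->.
by rewrite mulr0.
Qed.

(** Restricting to []0, T[] instead of []0, t[] gives one function for all [t <= T]; the kernel does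
    the cutting at [t]. Order 0 is excluded because [RLint] is then the identity. *)
Lemma RL0E a y t T : a != 0 -> t <= T -> RL0 a y t = RLk a (y \_ `]0, T[) t.
Proof.
move=> a0 tT; rewrite /RL0 /RLint (negPf a0) /RLk; congr (_ * _).
rewrite Rintegral_mkcond; apply: eq_Rintegral => s _.
rewrite !patchE !mem_setE !in_itv/= /powk subr_gt0.
case: (ltP 0 s) => s0 /=; last by rewrite mulr0.
case: (ltP s t) => st; last by rewrite !mul0r.
by rewrite (lt_le_trans st tT) !mul1r.
Qed.
End RiemannLiouville.

(** * Incomplete beta integrals and the bound by [xi] for the corrected integral *)

Section IncompleteBeta.
Context {R : realType}.
Local Notation mu := (@lebesgue_measure R).
Implicit Types (a b c h s t x z M : R) (y : R -> R).

Lemma Rintegral_affine c h (f : R -> R) : c != 0 ->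
  measurable_fun setT f -> (forall x, 0 <= f x) ->
  \int[mu]_x f x = `|c| * \int[mu]_x f (c * x + h).
Proof.
move=> c0 mf f0; rewrite /Rintegral (@ge0_integral_affine R c h)//; last exact/measurable_EFinP.
have cp : 0 < `|c| by rewrite normr_gt0.
(* If the integral is infinite, both sides are 0 by the convention for [fine]. *)
case: (\int[mu]_x _)%E => [r| |] //=.
- by rewrite mulry gtr0_sg// mul1e/= mulr0.
- by rewrite mulrNy gtr0_sg// mul1e/= mulr0.
Qed.

Lemma measurable_ltr z : measurable_fun setT (fun s => (s < z)%R%:R : R).
Proof.
rewrite (_ : (fun _ => _) = \1_`]-oo, z[%classic); first exact: measurable_indic.
by apply/funext => s; rewrite indicE mem_setE in_itv.
Qed.

Lemma measurable_ler z : measurable_fun setT (fun s => (s <= z)%R%:R : R).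
Proof.
rewrite (_ : (fun _ => _) = \1_`]-oo, z]%classic); first exact: measurable_indic.
by apply/funext => s; rewrite indicE mem_setE in_itv.
Qed.

Lemma measurable_ger z : measurable_fun setT (fun s => (z <= s)%R%:R : R).
Proof.
rewrite (_ : (fun _ => _) = \1_`[z, +oo[%classic); first exact: measurable_indic.
by apply/funext => s; rewrite indicE mem_setE in_itv/= andbT.
Qed.

Lemma measurable_powkMr a b t : measurable_fun setT (fun s => powk a (t - s) * powk b s).
Proof. by apply/measurable_EFinP; exact: measurable_powkM. Qed.

Lemma integrable_boolM (P : R -> bool) (f : R -> R) :
  measurable_fun setT (fun s => (P s)%:R : R) -> mu.-integrable setT (EFin \o f) ->
  mu.-integrable setT (EFin \o (fun s => (P s)%:R * f s)).
Proof.
move=> mP If; have /integrableP[/measurable_EFinP mf _] := If.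
apply: le_integrable If => //=.
  exact/measurable_EFinP/measurable_funM.
move=> s _; rewrite lee_fin normrM; case: (P s); first by rewrite normr1 mul1r.
by rewrite normr0 mul0r.
Qed.

Lemma incBetaE a b z : z <= 1 ->
  incBeta z a b = \int[mu]_s ((s < z)%R%:R * (powk b (1 - s) * powk a s)).
Proof.
move=> z1; rewrite /incBeta Rintegral_mkcond; apply: eq_Rintegral => s _.
rewrite patchE mem_setE in_itv/= /powk subr_gt0.
case: (ltP 0 s) => s0 /=; last by rewrite mul0r !mulr0.
case: (ltP s z) => sz; last by rewrite mul0r.
by rewrite (lt_le_trans sz z1) !mul1r mulrC.
Qed.

(** A single point is negligible. The closed inequality is the one that arises when [t <= s] is
    reflected. *)
Lemma incBetaE_le a b z : 0 < a -> 0 < b -> z <= 1 ->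
  incBeta z a b = \int[mu]_s ((s <= z)%R%:R * (powk b (1 - s) * powk a s)).
Proof.
move=> a0 b0 z1; rewrite incBetaE//.
transitivity (\int[mu]_(s in [set` Interval -oo%O (BLeft z)]) (powk b (1 - s) * powk a s)).
  rewrite [RHS]Rintegral_mkcond; apply: eq_Rintegral => s _.
  by rewrite patchE mem_setE in_itv/=; case: ifP => _; rewrite ?mul1r ?mul0r.
rewrite Rintegral_itv_bndo_bndc; last first.
  by apply: integrableS (integrable_powkM 1 b0 a0).
rewrite Rintegral_mkcond; apply: eq_Rintegral => s _.
by rewrite patchE mem_setE in_itv/=; case: ifP => _; rewrite ?mul1r ?mul0r.
Qed.

Lemma incBeta_ge0 a b z : 0 <= incBeta z a b.
Proof. by apply: Rintegral_ge0 => s _; rewrite mulr_ge0 ?powR_ge0. Qed.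

Lemma incBeta_le_Beta a b z : 0 < a -> 0 < b -> z <= 1 -> incBeta z a b <= Beta b a.
Proof.
move=> a0 b0 z1; rewrite incBetaE//.
have := @Rintegral_powkM R b a 1 b0 a0; rewrite powkE// powR1 mulr1 => <-.
apply: le_Rintegral => //.
- apply: integrable_boolM; first exact: measurable_ltr.
  exact: integrable_powkM.
- exact: integrable_powkM.
move=> s _; case: (s < z); first by rewrite mul1r.
by rewrite mul0r mulr_ge0 ?powk_ge0.
Qed.

Lemma Rintegral_lt_powkM a b t T : 0 < a -> 0 < b -> 0 < T -> t <= T ->
  \int[mu]_s ((s < t)%R%:R * (powk a (T - s) * powk b s)) =
  T `^ (a + b - 1) * incBeta (t / T) b a.
Proof.
move=> a0 b0 T0 tT; rewrite incBetaE; last by rewrite ler_pdivrMr ?mul1r.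
rewrite (Rintegral_affine 0 (lt0r_neq0 T0)); last 2 first.
- apply: measurable_funM; [exact: measurable_ltr|exact: measurable_powkMr].
- by move=> s; rewrite mulr_ge0// mulr_ge0 ?powk_ge0.
rewrite (@eq_Rintegral _ _ _ mu setT (fun s => T `^ (a - 1) * T `^ (b - 1) *
  ((s < t / T)%R%:R * (powk a (1 - s) * powk b s)))); last first.
  move=> s _; rewrite addr0 ltr_pdivlMr// [s * T]mulrC.
  by rewrite -[X in powk a (X - _)]mulr1 -mulrBr !powkZ//; ring.
rewrite RintegralZl//; last first.
  apply: integrable_boolM; first exact: measurable_ltr.
  exact: integrable_powkM.
rewrite mulrA gtr0_norm//; congr (_ * _).
have -> : a + b - 1 = 1 + ((a - 1) + (b - 1)) by ring.
by rewrite (@powRD _ T 1) ?(@powRD _ T (a - 1)) ?(gt_eqF T0) ?implybT// powRr1 ?ltW.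
Qed.

(** The substitution [s -> T - T * s] turns the upper part of the interval into a lower part and
    exchanges the two kernels, hence the order of [a] and [b] in [incBeta]. *)
Lemma Rintegral_ge_powkM a b t T : 0 < a -> 0 < b -> 0 < T -> 0 <= t ->
  \int[mu]_s ((t <= s)%R%:R * (powk a (T - s) * powk b s)) =
  T `^ (a + b - 1) * incBeta (1 - t / T) a b.
Proof.
move=> a0 b0 T0 t0; rewrite incBetaE_le//; last first.
  by rewrite gerBl divr_ge0// ltW.
have T0' : - T != 0 by rewrite oppr_eq0 gt_eqF.
rewrite (Rintegral_affine T T0'); last 2 first.
- apply: measurable_funM; [exact: measurable_ger|exact: measurable_powkMr].
- by move=> s; rewrite mulr_ge0// mulr_ge0 ?powk_ge0.
rewrite (@eq_Rintegral _ _ _ mu setT (fun s => T `^ (a - 1) * T `^ (b - 1) *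
  ((s <= 1 - t / T)%R%:R * (powk b (1 - s) * powk a s)))); last first.
  move=> s _; have -> : T - (- T * s + T) = T * s by ring.
  have -> : - T * s + T = T * (1 - s) by ring.
  have -> : (t <= T * (1 - s)) = (s <= 1 - t / T).
    by rewrite lerBrDr -lerBrDl ler_pdivrMr// mulrC.
  by rewrite !powkZ//; ring.
rewrite RintegralZl//; last first.
  apply: integrable_boolM; first exact: measurable_ler.
  exact: integrable_powkM.
rewrite normrN mulrA gtr0_norm//; congr (_ * _).
have -> : a + b - 1 = 1 + ((a - 1) + (b - 1)) by ring.
by rewrite (@powRD _ T 1) ?(@powRD _ T (a - 1)) ?(gt_eqF T0) ?implybT// powRr1 ?ltW.
Qed.

Lemma ler_npowR p x z : 0 < x -> x <= z -> p <= 0 -> z `^ p <= x `^ p.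
Proof.
move=> x0 xy p0; have y0 := lt_le_trans x0 xy.
rewrite -[p]opprK !(powRN _ (- p)) lef_pV2 ?posrE ?powR_gt0//.
by apply: ge0_ler_powR; rewrite ?nnegrE ?oppr_ge0// ltW.
Qed.

(** Both exponents [- zeta] and [zeta - 1] are nonpositive, so the left side only grows when [T] is
    replaced by [t]. The claim then reads [((t - s) / t)]^ (zeta - alpha) <=
    1[, up to the common factor](t - s) [^ (alpha - 1)]. *)
Lemma correction_kernel_le (alpha zeta s t T : R) :
  0 < alpha -> alpha <= zeta <= 1 -> 0 < s -> s < t -> t <= T ->
  t `^ alpha * T `^ (- zeta) * powk zeta (T - s) <= powk alpha (t - s).
Proof.
move=> a0 /andP[az z1] s0 st tT; have t0 := lt_trans s0 st; have T0 := lt_le_trans t0 tT.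
have ts0 : 0 < t - s by rewrite subr_gt0.
have Ts0 : 0 < T - s by rewrite subr_gt0 (lt_le_trans st).
rewrite !powkE//.
apply: (@le_trans _ _ (t `^ alpha * t `^ (- zeta) * (t - s) `^ (zeta - 1))).
  apply: ler_pM; rewrite ?mulr_ge0 ?powR_ge0//.
    by rewrite ler_wpM2l ?powR_ge0// ler_npowR// oppr_le0; lra.
  by rewrite ler_npowR//; lra.
have -> : (t - s) `^ (zeta - 1) = (t - s) `^ (zeta - alpha) * (t - s) `^ (alpha - 1).
  by rewrite -powRD ?(gt_eqF ts0) ?implybT//; congr (_ `^ _); ring.
rewrite mulrA -[leRHS]mul1r ler_wpM2r ?powR_ge0//.
have -> : 1 = t `^ alpha * t `^ (- zeta) * t `^ (zeta - alpha).
  rewrite -!powRD ?(gt_eqF t0) ?implybT//.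
  by rewrite (_ : _ + _ = 0) ?powRr0//; ring.
rewrite ler_wpM2l ?mulr_ge0 ?powR_ge0//.
by apply: ge0_ler_powR; rewrite ?nnegrE ?subr_ge0//; lra.
Qed.

Section CorrectedIntegral.
Variables (alpha gamma zeta T M t : R) (y : R -> R).
Hypotheses (a0 : 0 < alpha) (ag : alpha <= gamma) (g1 : gamma <= 1).
Hypotheses (zE : zeta = 1 - gamma + alpha) (t0 : 0 < t) (tT : t <= T).
Hypothesis yM : dominated gamma M y.

Let T0 : 0 < T. Proof. exact: lt_le_trans tT. Qed.
Let g0 : 0 < gamma. Proof. exact: lt_le_trans ag. Qed.
Let z0 : 0 < zeta. Proof. by rewrite zE ltr_wpDl// subr_ge0. Qed.
Let az : alpha <= zeta <= 1.
Proof.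
by rewrite zE lerDr subr_ge0 g1 -addrA gerDl addrC subr_le0.
Qed.

Let C := t `^ alpha * T `^ (- zeta).
(** This ratio is what the Gamma factors of the correction term leave once [(Gamma alpha)^-1] is
    taken out of both integrals. *)
Let k := zeta / alpha.

(* The kernel [kappa] of the corrected integral may change sign on [(0, t)].
   Since [C * powk zeta (T - s) <= powk alpha (t - s)] there and [1 <= k],
   [|kappa s| <= powk alpha (t - s) + (k - 2) * (C * powk zeta (T - s))]; the
   weight [k - 2] is the source of the coefficient
   [1 - gamma - alpha = zeta - 2 * alpha] in [xi]. *)
Let kappa s := powk alpha (t - s) - k * (C * powk zeta (T - s)).
Let lam s := powk alpha (t - s) * powk gamma s +
  ((k - 2) * C * ((s < t)%R%:R * (powk zeta (T - s) * powk gamma s)) +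
   k * C * ((t <= s)%R%:R * (powk zeta (T - s) * powk gamma s))).

Let k1 : 1 <= k. Proof. by rewrite /k ler_pdivlMr// mul1r; case/andP: az. Qed.
Let C0 : 0 <= C. Proof. by rewrite mulr_ge0 ?powR_ge0. Qed.

Let kappa_le s : `|kappa s * y s| <= M * lam s.
Proof.
have [_ /(_ s) ys] := yM.
have [s0|s0] := leP s 0.
  have -> : y s = 0.
    by apply/eqP; rewrite -normr_le0 (le_trans ys)// powk_le0 ?mulr0.
  by rewrite mulr0 normr0 /lam (powk_le0 gamma s0) !mulr0 !addr0 mulr0.
suff [L [kL E]] : exists L, `|kappa s| <= L /\ lam s = L * powk gamma s.
  by rewrite E normrM mulrCA; apply: ler_pM.
have P0 := powk_ge0 alpha (t - s).
have Q0 : 0 <= C * powk zeta (T - s) by rewrite mulr_ge0 ?powk_ge0.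
rewrite /lam /kappa; case: (ltP s t) => st.
  exists (powk alpha (t - s) + (k - 2) * (C * powk zeta (T - s))); split; last by rewrite /=; ring.
  have QP := correction_kernel_le a0 az s0 st tT.
  rewrite -/C in QP.
  set P := powk alpha _ in P0 QP *; set Q := C * _ in Q0 QP *.
  (* The bound [|P - k * Q| <= P + (k - 2) * Q] amounts to [0 <= (k - 1) * Q] on one side and to
     [Q <= P] on the other. *)
  have h : 0 <= (k - 1) * Q by rewrite mulr_ge0// subr_ge0.
  by rewrite ler_norml; apply/andP; split; nra.
exists (k * (C * powk zeta (T - s))); split; last first.
  by rewrite (@powk_le0 _ alpha) ?subr_le0//=; ring.
rewrite (@powk_le0 _ alpha) ?subr_le0// sub0r normrN ger0_norm// mulr_ge0//.
by rewrite (le_trans ler01).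
Qed.

(** The difference is a single integral against [kappa], bounded through [kappa_le] by [M] times the
    integral of [lam]. The latter is a complete beta integral plus two incomplete ones, which
    reproduce [xi] exactly. *)
Lemma corrected_RLk_le :
  t `^ (1 - gamma) * `|RLk alpha y t -
    Gamma (zeta + 1) * t `^ alpha / (Gamma (alpha + 1) * T `^ zeta) * RLk zeta y T| <=
  (Gamma gamma * t `^ alpha / Gamma (gamma + alpha) +
  (t / T) `^ zeta * T `^ alpha / Gamma (alpha + 1) *
    ((1 - gamma - alpha) * incBeta (t / T) gamma zeta +
     zeta * incBeta (1 - t / T) zeta gamma)) * M.
Proof.
have Ga0 := Gamma_gt0 a0; have Gz0 := Gamma_gt0 z0.
have Tz : T `^ zeta != 0 by rewrite gt_eqF ?powR_gt0.
have iP := integrable_powkM t a0 g0; have iQ := integrable_powkM T z0 g0.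
have iy1 := integrable_dominated t a0 g0 yM; have iy2 := integrable_dominated T z0 g0 yM.
have i1 := integrable_boolM (measurable_ltr t) iQ.
have i2 := integrable_boolM (measurable_ger t) iQ.
have -> : RLk alpha y t -
    Gamma (zeta + 1) * t `^ alpha / (Gamma (alpha + 1) * T `^ zeta) * RLk zeta y T =
  (Gamma alpha)^-1 * \int[mu]_s (kappa s * y s).
  have -> : \int[mu]_s (kappa s * y s) =
     \int[mu]_s (powk alpha (t - s) * y s) - k * C * \int[mu]_s (powk zeta (T - s) * y s).
    rewrite -(RintegralZl (k * C))// -RintegralB//; last first.
      by have := integrableZl measurableT (k * C) iy2.
    by apply: eq_Rintegral => s _; rewrite /kappa; ring.
  rewrite /RLk !GammaS// /k /C powRN; field.
  by rewrite Tz !gt_eqF.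
have ilam : mu.-integrable setT (EFin \o lam).
  have i1' := integrableZl measurableT ((k - 2) * C) i1.
  have i2' := integrableZl measurableT (k * C) i2.
  exact: (integrableD measurableT iP (integrableD measurableT i1' i2')).
have ik : mu.-integrable setT (EFin \o (fun s => kappa s * y s)).
  have j := integrableB measurableT iy1 (integrableZl measurableT (k * C) iy2).
  apply: eq_integrable j => // s _ /=.
  by congr EFin; rewrite /kappa; ring.
have le1 : `|\int[mu]_s (kappa s * y s)| <= M * \int[mu]_s lam s.
  rewrite (le_trans (le_normr_Rintegral _ ik))// -RintegralZl//.
  apply: le_Rintegral => //; first exact: integrable_norm.
  by have := integrableZl measurableT M ilam.
have lamE : \int[mu]_s lam s = Beta alpha gamma * t `^ (alpha + gamma - 1) +
   C * T `^ alpha * ((k - 2) * incBeta (t / T) gamma zeta + k * incBeta (1 - t / T) zeta gamma).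
  have i1' := integrableZl measurableT ((k - 2) * C) i1.
  have i2' := integrableZl measurableT (k * C) i2.
  rewrite /lam RintegralD//; last exact: (integrableD measurableT i1' i2').
  rewrite RintegralD// !RintegralZl// Rintegral_powkM// powkE//.
  rewrite Rintegral_lt_powkM// Rintegral_ge_powkM// ?ltW//.
  have -> : zeta + gamma - 1 = alpha by rewrite zE; ring.
  by ring.
rewrite normrM gtr0_norm ?invr_gt0//.
apply: (@le_trans _ _ (t `^ (1 - gamma) * ((Gamma alpha)^-1 * (M * \int[mu]_s lam s)))).
  by rewrite ler_wpM2l ?powR_ge0// ler_wpM2l// invr_ge0 ltW.
rewrite lamE /Beta GammaS// /C /k [gamma + alpha]addrC.
(* The two sides are equal. Writing the powers of [t] through [t]^ alpha[and]t [^ (1 - gamma)] makes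
   this a rational identity. *)
have -> : t `^ (alpha + gamma - 1) = t `^ alpha / t `^ (1 - gamma).
  by rewrite -powRB ?(gt_eqF t0) ?implybT//; congr (_ `^ _); ring.
have -> : (t / T) `^ zeta = t `^ alpha * t `^ (1 - gamma) * T `^ (- zeta).
  rewrite powRM ?invr_ge0 ?ltW// -[T^-1]powR_inv1 ?ltW// -powRrM mulN1r; congr (_ * _).
  rewrite -powRD ?(gt_eqF t0) ?implybT//; congr (_ `^ _); rewrite zE; ring.
rewrite le_eqVlt; apply/orP; left; apply/eqP.
have tg : t `^ (1 - gamma) != 0 by rewrite gt_eqF ?powR_gt0.
have Gag : Gamma (alpha + gamma) != 0 by rewrite gt_eqF ?Gamma_gt0 ?addr_gt0.
have -> : 1 - gamma - alpha = zeta - 2 * alpha by rewrite zE; ring.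
have anz := lt0r_neq0 a0; have Gnz := lt0r_neq0 Ga0.
move: (incBeta _ _ _) (incBeta _ _ _) (Gamma gamma) Gag anz Gnz tg => I1 I2.
move: (Gamma alpha) (Gamma _) (t `^ (1 - gamma)) (t `^ alpha) (T `^ (- zeta)) (T `^ alpha).
move=> Ga Gag tg ta Tz' Ta Gg Gag0 anz Gnz tg0; field.
by rewrite tg0 Gag0 anz Gnz.
Qed.
End CorrectedIntegral.
End IncompleteBeta.

(** * The weighted space of continuous functions and its norm *)

Section WeightedContinuous.
Context {R : realType}.
Local Notation mu := (@lebesgue_measure R).
Implicit Types (a b c h s t x z M T gamma : R) (y f : R -> R).

(** The continuous extension attains its extrema on [[0, T]]. Boundedness makes the [sup] in
    [wCnorm] a genuine upper bound, not a default value. *)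
Lemma wC_bounded gamma T f : 0 < T -> wC gamma T f ->
  has_ubound [set `|t `^ (1 - gamma) * f t| | t in `]0, T]].
Proof.
move=> T0 [g [cg gE]].
have [M _ gM] := EVT_max (ltW T0) cg.
have [m _ gm] := EVT_min (ltW T0) cg.
exists (`|g M| + `|g m|) => _ [t /= tT <-].
move: (tT); rewrite in_itv/= => /gE <-.
have tT' : t \in `[0, T] by move: tT; rewrite !in_itv/= => /andP[/ltW -> ->].
have h1 := gM _ tT'; have h2 := gm _ tT'.
have := ler_norm (g M); have := ler_norm (- g m); rewrite normrN.
have := normr_ge0 (g M); have := normr_ge0 (g m).
by move=> *; rewrite ler_norml; apply/andP; split; lra.
Qed.

Lemma le_wCnorm gamma T f t : 0 < T -> wC gamma T f -> 0 < t <= T ->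
  `|t `^ (1 - gamma) * f t| <= wCnorm gamma T f.
Proof.
move=> T0 wf tT; apply: ub_le_sup; first exact: wC_bounded.
by exists t => //=; rewrite in_itv.
Qed.

Lemma wCnorm_le gamma T f M : 0 < T ->
  (forall t, 0 < t <= T -> `|t `^ (1 - gamma) * f t| <= M) -> wCnorm gamma T f <= M.
Proof.
move=> T0 fM; apply: ge_sup.
  by exists `|T `^ (1 - gamma) * f T|; exists T => //=; rewrite in_itv/= T0 lexx.
by move=> _ [t /= + <-]; rewrite in_itv/= => /fM.
Qed.

Lemma wCnorm_ge0 gamma T f : 0 < T -> wC gamma T f -> 0 <= wCnorm gamma T f.
Proof.
by move=> T0 wf; rewrite (le_trans _ (@le_wCnorm _ _ _ T T0 wf _))// T0 lexx.
Qed.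

Lemma wC_measurable gamma T f : wC gamma T f -> measurable_fun `]0, T[ f.
Proof.
move=> [g [cg gE]].
have mg : measurable_fun `]0, T[ g.
  apply: (@measurable_funS _ _ _ _ `[0, T]) => //.
    exact: subset_itv_oo_cc.
  exact: subspace_continuous_measurable_fun.
apply: (@eq_measurable_fun _ _ _ _ _ (fun s => g s * s `^ (gamma - 1))); last first.
  by apply: measurable_funM => //; apply: measurable_funTS; exact: measurable_powR.
move=> s; rewrite inE/= in_itv/= => /andP[s0 sT].
rewrite gE ?s0 ?ltW// mulrAC -powRD ?(gt_eqF s0) ?implybT//.
by rewrite (_ : _ + _ = 0) ?powRr0 ?mul1r//; ring.
Qed.

Lemma wC_dominated gamma T f M : 0 < T -> wC gamma T f -> wCnorm gamma T f <= M ->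
  dominated gamma M (f \_ `]0, T[).
Proof.
move=> T0 wf fM; split.
  by apply/(measurable_restrictT _ _).1 => //; exact: wC_measurable wf.
move=> s; rewrite patchE mem_setE in_itv/=.
have M0 : 0 <= M := le_trans (wCnorm_ge0 T0 wf) fM.
case: ifP => [/andP[s0 sT]|_]; last by rewrite normr0 mulr_ge0 ?powk_ge0.
have := le_trans (@le_wCnorm gamma T f s T0 wf _) fM; rewrite s0 ltW// => /(_ isT).
rewrite normrM ger0_norm ?powR_ge0// powkE// -(@opprB _ 1) powRN.
by rewrite ler_pdivlMr ?powR_gt0// mulrC.
Qed.

Lemma wCB gamma T f y : wC gamma T f -> wC gamma T y -> wC gamma T (f \- y).
Proof.
move=> [g [cg gE]] [h [ch hE]]; exists (g \- h); split.
  by move=> z; apply: cvgB; [exact: cg|exact: ch].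
by move=> t tT; rewrite /= gE// hE// mulrBr.
Qed.

Lemma RLkB a b M1 M2 y1 y2 t : 0 < a -> 0 < b -> dominated b M1 y1 -> dominated b M2 y2 ->
  RLk a (y1 \- y2) t = RLk a y1 t - RLk a y2 t.
Proof.
move=> a0 b0 d1 d2; rewrite /RLk -mulrBr -RintegralB//.
- by congr (_ * _); apply: eq_Rintegral => s _; rewrite /= mulrBr.
- exact: integrable_dominated d1.
- exact: integrable_dominated d2.
Qed.
End WeightedContinuous.

(** * Bounds on the parameters, and the operator [Top] in the weighted norm *)

Section HilferParameters.
Context {R : realType}.
Variables (alpha beta T : R).
Hypotheses (T0 : 0 < T) (a01 : 0 < alpha < 1) (b01 : 0 <= beta <= 1).
Local Notation gamma := (hgamma alpha beta).
Local Notation zeta := (hzeta alpha beta).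

Lemma le_alpha_hgamma : alpha <= gamma.
Proof. by rewrite /hgamma; move: a01 b01 => /andP[? ?] /andP[? ?]; nra. Qed.

Lemma hgamma_le1 : gamma <= 1.
Proof. by rewrite /hgamma; move: a01 b01 => /andP[? ?] /andP[? ?]; nra. Qed.

Lemma hgamma_gt0 : 0 < gamma.
Proof. by case/andP: a01 => a0 _; rewrite (lt_le_trans a0) ?le_alpha_hgamma. Qed.

Lemma hzeta_gt0 : 0 < zeta.
Proof. by case/andP: a01 => a0 _; rewrite /hzeta ltr_wpDl// subr_ge0 hgamma_le1. Qed.

Lemma xi_le_Xi t : 0 < t <= T -> xi alpha beta T t <= Xi alpha beta T.
Proof.
have g0 := hgamma_gt0; have z0 := hzeta_gt0; have /andP[a0 a1] := a01.
move=> tT; apply: ub_le_sup; last by exists t => //=; rewrite in_itv.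
(* An upper bound of [xi] uniform in [t]: the powers are monotone, each incomplete beta is at most
   the complete one, and the absolute value covers either sign of [1 - gamma - alpha]. *)
exists (Gamma gamma * T `^ alpha / Gamma (gamma + alpha) +
  T `^ alpha / Gamma (alpha + 1) * (`|1 - gamma - alpha| * Beta zeta gamma +
     zeta * Beta gamma zeta)) => _ [s /= + <-].
rewrite in_itv/= => /andP[s0 sT]; rewrite /xi.
have h1 : 0 < s / T by rewrite divr_gt0.
have h2 : s / T <= 1 by rewrite ler_pdivrMr ?mul1r.
have h3 : 1 - s / T <= 1 by rewrite gerBl ltW.
apply: lerD.
  rewrite ler_wpM2r//; first by rewrite invr_ge0 ltW// Gamma_gt0// addr_gt0.
  rewrite ler_wpM2l//; first by rewrite ltW// Gamma_gt0.
  by apply: ge0_ler_powR; rewrite ?nnegrE// ltW.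
have W0 : 0 <= T `^ alpha / Gamma (alpha + 1).
  by rewrite divr_ge0 ?powR_ge0// ltW ?Gamma_gt0// addr_gt0.
rewrite -[X in X * _ <= _]mulrA -[leLHS]mulrA.
apply: (@le_trans _ _ ((s / T) `^ zeta * (T `^ alpha / Gamma (alpha + 1) *
   (`|1 - gamma - alpha| * Beta zeta gamma + zeta * Beta gamma zeta)))).
  rewrite ler_wpM2l ?powR_ge0// ler_wpM2l// lerD//.
    rewrite (le_trans (ler_norm _))// normrM (ger0_norm (incBeta_ge0 _ _ _)).
    by apply: ler_wpM2l; [exact: normr_ge0|exact: incBeta_le_Beta].
  by apply: ler_wpM2l; [exact: ltW|exact: incBeta_le_Beta].
rewrite -[leRHS]mul1r ler_wpM2r//.
  apply: mulr_ge0 W0 _; apply: addr_ge0; apply: mulr_ge0.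
  - exact: normr_ge0.
  - exact: ltW (Beta_gt0 z0 g0).
  - exact: ltW z0.
  - exact: ltW (Beta_gt0 g0 z0).
have -> : (1 : R) = 1 `^ zeta by rewrite powR1.
apply: ge0_ler_powR; rewrite ?nnegrE//; exact: ltW.
Qed.

Context {d : nat}.
Implicit Types y : R -> 'cV[R]_d.

Lemma TopE y t i : t <= T -> Top alpha beta T y t i 0 =
  RLk alpha (vcomp y i \_ `]0, T[) t -
  Gamma (zeta + 1) * t `^ alpha / (Gamma (alpha + 1) * T `^ zeta) *
  RLk zeta (vcomp y i \_ `]0, T[) T.
Proof.
case/andP: a01 => a0 _ tT.
by rewrite !mxE (RL0E _ _ tT) ?gt_eqF// (RL0E _ _ (lexx T)) ?gt_eqF ?hzeta_gt0.
Qed.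

(** Used twice: with [M] an entry of [m] it keeps the iterates in the ball around [xinit], and with
    [M] a bound on a difference it gives the continuity of [Top] needed in the limit. *)
Lemma Top_le y t i M : 0 < t <= T -> wC gamma T (vcomp y i) ->
  wCnorm gamma T (vcomp y i) <= M ->
  `|t `^ (1 - gamma) * Top alpha beta T y t i 0| <= Xi alpha beta T * M.
Proof.
move=> /[dup] tT /andP[t0 tT'] wy yM; have /andP[a0 a1] := a01.
rewrite TopE// normrM (ger0_norm (powR_ge0 _ _)).
have D := wC_dominated T0 wy yM.
apply: (le_trans (corrected_RLk_le a0 le_alpha_hgamma hgamma_le1 (erefl _) t0 tT' D)).
rewrite ler_wpM2r//; last exact: xi_le_Xi.
exact: le_trans (wCnorm_ge0 T0 wy) yM.
Qed.

Lemma TopB y1 y2 t i : t <= T -> wC gamma T (vcomp y1 i) -> wC gamma T (vcomp y2 i) ->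
  Top alpha beta T (y1 \- y2) t i 0 = Top alpha beta T y1 t i 0 - Top alpha beta T y2 t i 0.
Proof.
move=> tT w1 w2; have /andP[a0 _] := a01.
rewrite !TopE//.
have -> : vcomp (y1 \- y2) i \_ `]0, T[ = (vcomp y1 i \_ `]0, T[) \- (vcomp y2 i \_ `]0, T[).
  apply/funext => s; rewrite /= !patchE; case: ifP => _; last by rewrite subr0.
  by rewrite /vcomp !mxE.
have D1 := wC_dominated T0 w1 (lexx _); have D2 := wC_dominated T0 w2 (lexx _).
rewrite (RLkB t a0 hgamma_gt0 D1 D2) (RLkB T hzeta_gt0 hgamma_gt0 D1 D2) mulrBr.
by rewrite !opprB addrACA [RHS]addrACA; congr (_ + _); exact: addrC.
Qed.

End HilferParameters.

(** * Iterates in [X_D], the fixed point equation of the limit, and its value at [T] *)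

Section FixedPoint.
Context {R : realType} {d : nat}.
Local Notation mu := (@lebesgue_measure R).
Implicit Types (s t T M : R) (u v x : R -> 'cV[R]_d).

Lemma vwCB gamma T u v : vwC gamma T u -> vwC gamma T v -> vwC gamma T (u \- v).
Proof.
move=> wu wv i.
rewrite (_ : vcomp _ _ = vcomp u i \- vcomp v i); first exact: wCB (wu i) (wv i).
by apply/funext => r; rewrite /vcomp !mxE.
Qed.

Lemma wC_cvg_pointwise gamma T (u : nat -> R -> 'cV[R]_d) x t i :
  0 < t <= T -> cvg_wC gamma T u x ->
  t `^ (1 - gamma) * u n t i 0 @[n --> \oo] --> t `^ (1 - gamma) * x t i 0.
Proof.
move=> /[dup] tT /andP[t0 tT'] [wu wx cu]; have T0 := lt_le_trans t0 tT'.
apply/cvgrPdist_le => e e0.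
have /cvgrPdist_le/(_ e e0) := cu i; apply: filterS => n.
rewrite sub0r normrN => h; rewrite distrC -mulrBr.
apply: le_trans h; rewrite (le_trans _ (ler_norm _))//.
have w := vwCB (wu n) wx i.
by have := le_wCnorm T0 w tT; rewrite {1}/vcomp !mxE.
Qed.

(** Convergence in the weighted norm gives convergence of the weighted values at each [t], and [D]
    is closed. Balls of column vectors are entrywise, so finitely many scalar limits suffice. *)
Lemma X_closed gamma T (D : set 'cV[R]_d) (u : nat -> R -> 'cV[R]_d) x :
  closed D -> (forall n, X_ gamma T D (u n)) -> cvg_wC gamma T u x -> X_ gamma T D x.
Proof.
move=> cD uX cu; split; first by case: cu.
move=> t tT.
apply: (@closed_cvg nat _ \oo _ (fun n => t `^ (1 - gamma) *: u n t) D cD).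
  by apply: nearW => n; have [_] := uX n; exact.
apply/cvg_ballP => e e0.
have : forall i, \forall n \near \oo,
   ball (t `^ (1 - gamma) * x t i 0) e (t `^ (1 - gamma) * u n t i 0).
  move=> i; have /cvg_ballP := @wC_cvg_pointwise gamma T u x t i tT cu.
  exact.
move=> /filter_forall; apply: filterS => n h; split=> // i j.
by rewrite ord1 !mxE.
Qed.

Lemma xinitE alpha beta (x0 : 'cV[R]_d) t : 0 < t ->
  t `^ (1 - hgamma alpha beta) *: xinit alpha beta x0 t = (Gamma (hgamma alpha beta))^-1 *: x0.
Proof.
move=> t0; rewrite /xinit scalerA mulrA -powRD ?(gt_eqF t0) ?implybT//.
by rewrite (_ : _ + _ = 0) ?powRr0 ?mul1r//; ring.
Qed.

Section Picard.
Variables (T alpha beta : R) (x0 : 'cV[R]_d) (D : set 'cV[R]_d).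
Variables (f : R -> 'cV[R]_d -> 'cV[R]_d) (m : 'cV[R]_d) (K : 'M[R]_d).
Variable x : R -> 'cV[R]_d.
Local Notation gamma := (hgamma alpha beta).
Local Notation zeta := (hzeta alpha beta).
Local Notation X_D := (X_ gamma T D).
Hypotheses (T0 : 0 < T) (a01 : 0 < alpha < 1) (b01 : 0 <= beta <= 1).
Hypothesis cD : closed D.
Hypothesis x0D : D ((Gamma gamma)^-1 *: x0).
Hypothesis ballX : [set u | vwC gamma T u /\
           mx_le (vwCnorm gamma T (u \- xinit alpha beta x0))
                 (Xi alpha beta T *: m)] `<=` X_D.
Hypothesis fwC : forall u, X_D u -> vwC gamma T (fun t => f t (u t)).
Hypothesis fm : forall u, X_D u -> mx_le (vwCnorm gamma T (fun t => f t (u t))) m.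
Hypothesis fK : forall u v t, X_D u -> X_D v -> 0 < t <= T ->
     mx_le (mx_abs (f t (u t) - f t (v t))) (K *m mx_abs (u t - v t)).
Hypothesis K0 : mx_le 0 K.
Hypothesis cx : cvg_wC gamma T (xseq alpha beta T f x0) x.

Lemma xseq_X n : X_D (xseq alpha beta T f x0 n).
Proof.
have [wu _ _] := cx.
elim: n => [|n ih].
  (* The weighted initial function is the constant [x0 / Gamma gamma], a point of [D]. *)
  by split; [exact: wu 0%N|move=> t /andP[t0 _]; rewrite xinitE].
apply: ballX; split; first exact: wu.
move=> i j; rewrite ord1 !mxE; apply: wCnorm_le => // t tT.
(* The distance from the next iterate to [xinit] is exactly the [Top] term. *)
rewrite /vcomp /= addrAC subrr add0r.
by apply: Top_le => //; [exact: fwC|have := fm ih i 0; rewrite mxE].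
Qed.

Lemma limit_X : X_D x.
Proof. exact: X_closed cD xseq_X cx. Qed.

(** The weighted defect [c] of the equation at [t] does not depend on [n], yet is at most
    [|e n| + Xi * b n], which tends to 0. Here [b n] is row [i] of [K] applied to the distances from
    the iterate to the limit. *)
Lemma limit_fixed_point t : 0 < t <= T ->
  x t = xinit alpha beta x0 t + Top alpha beta T (fun s => f s (x s)) t.
Proof.
move=> /[dup] tT /andP[t0 tT']; apply/matrixP => i j; rewrite ord1 {j}.
have [wu wx cu] := cx; have xX := limit_X.
pose w n j := wCnorm gamma T (vcomp (xseq alpha beta T f x0 n \- x) j).
pose F n s := f s (xseq alpha beta T f x0 n s); pose G s := f s (x s).
have wd n j := vwCB (wu n) wx j.
have wF n : vwC gamma T (F n) := fwC (xseq_X n).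
have wG : vwC gamma T G := fwC xX.
have wFG n := vwCB (wF n) wG i.
pose b n := \sum_j K i j * w n j.
have FGb n : wCnorm gamma T (vcomp (F n \- G) i) <= b n.
  apply: wCnorm_le => // s sT.
  have := fK (xseq_X n) xX sT i 0; rewrite normrM ger0_norm ?powR_ge0// !mxE => h.
  rewrite /vcomp !mxE; apply: le_trans (ler_wpM2l (powR_ge0 _ _) h) _.
  rewrite mulr_sumr; apply: ler_sum => j _; rewrite mulrCA.
  apply: ler_wpM2l; first by have := K0 i j; rewrite mxE.
  have := le_wCnorm T0 (wd n j) sT; rewrite normrM ger0_norm ?powR_ge0//.
  by rewrite {1}/vcomp !mxE.
(* The index is [n.+1] because the recursion gives [Top (F n)] through the next iterate. *)
pose e n := t `^ (1 - gamma) * xseq alpha beta T f x0 n.+1 t i 0 - t `^ (1 - gamma) * x t i 0.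
pose c := `|t `^ (1 - gamma) * (x t i 0 - xinit alpha beta x0 t i 0 - Top alpha beta T G t i 0)|.
have cle n : c <= `|e n| + Xi alpha beta T * b n.
  have := Top_le T0 a01 b01 tT (wFG n) (FGb n).
  rewrite (TopB T0 a01 b01 tT' (wF n i) (wG i)) => h.
  apply: le_trans (lerD (lexx _) h); rewrite -[`|e n|]normrN.
  apply: le_trans (ler_normD _ _); rewrite le_eqVlt; apply/orP; left; apply/eqP.
  have xS : xseq alpha beta T f x0 n.+1 t i 0 =
      xinit alpha beta x0 t i 0 + Top alpha beta T (F n) t i 0 by rewrite [LHS]mxE.
  by rewrite /c /e xS; congr (`|_|); ring.
have ac : `|e n| + Xi alpha beta T * b n @[n --> \oo] --> `|0 : R| + Xi alpha beta T * 0.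
  apply: cvgD.
    apply: cvg_norm; rewrite -(subrr (t `^ (1 - gamma) * x t i 0)).
    apply: cvgB; last exact: cvg_cst.
    have := @wC_cvg_pointwise gamma T _ x t i tT cx.
    by rewrite -cvg_shiftS.
  apply: cvgM; first exact: cvg_cst.
  have -> : 0 = \sum_j K i j * 0 by rewrite big1// => j _; rewrite mulr0.
  apply: cvg_big => [|j _]; first exact: add_continuous.
  apply: cvgM; first exact: cvg_cst.
  exact: cu.
have : c <= 0.
  rewrite normr0 mulr0 addr0 in ac; apply: (cvgr_to_ge ac); exact: nearW cle.
rewrite normr_le0 mulf_eq0 gt_eqF ?powR_gt0//= -addrA -opprD subr_eq0 => /eqP ->.
by rewrite [RHS]mxE.
Qed.

End Picard.

(** The vanishing of [I^zeta y] at [T] acts twice: it removes the correction in [Top], and by the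
    semigroup law it removes [I^(1 - gamma) I^alpha y] at [T]. What is left is [I^(1 - gamma)] of
    the initial power function. *)
Lemma RL0_fixed_point (T alpha beta : R) (x0 : 'cV[R]_d) x y i :
  0 < T -> 0 < alpha < 1 -> 0 <= beta <= 1 ->
  wC (hgamma alpha beta) T (vcomp y i) ->
  (forall t, 0 < t <= T -> x t = xinit alpha beta x0 t + Top alpha beta T y t) ->
  RL0 (hzeta alpha beta) (vcomp y i) T = 0 ->
  RL0 (1 - hgamma alpha beta) (vcomp x i) T = x0 i 0.
Proof.
move=> T0 a01 b01 wy xE y0; have /andP[a0 a1] := a01.
have g0 := hgamma_gt0 a01 b01; have g1 := hgamma_le1 a01 b01.
have z0 := hzeta_gt0 a01 b01.
set g := hgamma alpha beta in g0 g1 wy *; set z := hzeta alpha beta in z0 y0 *.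
have zE : z = 1 - g + alpha by [].
rewrite (RL0E _ (lt0r_neq0 z0) (lexx T)) in y0.
have dy := wC_dominated T0 wy (lexx _).
have {}xE t : 0 < t <= T ->
   x t i 0 = x0 i 0 / Gamma g * powk g t + RLk alpha (vcomp y i \_ `]0, T[) t.
  move=> /[dup] tT /andP[t0 tT']; rewrite xE// mxE; congr (_ + _).
    by rewrite mxE powkE// mulrC mulrAC -mulrA.
  by rewrite (TopE a01 b01)// y0 mulr0 subr0.
have [g1'|g1'] := eqVneq (1 - g) 0.
  (* For [gamma = 1] the integral of order 0 is the identity and [zeta = alpha], so the fixed point
     equation at [T] gives the value directly. *)
  rewrite /RL0 /RLint g1' eqxx /vcomp xE ?T0 ?lexx//.
  have gE : g = 1 by lra.
  have -> : alpha = z by rewrite zE g1' add0r.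
  by rewrite y0 addr0 gE Gamma1 divr1 powk1 T0 mulr1.
have g'0 : 0 < 1 - g by rewrite lt0r g1' subr_ge0.
rewrite (RL0E _ g1' (lexx T)) /RLk.
rewrite (@eq_Rintegral _ _ _ mu setT (fun s =>
   x0 i 0 / Gamma g * (powk (1 - g) (T - s) * powk g s) +
   powk (1 - g) (T - s) * RLk alpha (vcomp y i \_ `]0, T[) s)); last first.
  move=> s _; rewrite patchE mem_setE in_itv/=.
  have [s0|s0] := leP s 0.
    by rewrite (powk_le0 g s0) (RLk_le0 a0 s0 dy) !mulr0 addr0.
  have [sT|sT] := ltP s T; last first.
    by rewrite (@powk_le0 _ (1 - g) (T - s)) ?subr_le0// !mul0r mulr0 addr0.
  by rewrite /= -[vcomp x i s]/(x s i 0) xE ?s0 ?ltW// mulrDr mulrCA.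
have i1 := integrable_powkM T g'0 g0.
have i1' := integrableZl measurableT (x0 i 0 / Gamma g) i1.
have i2 := integrable_RLk T g'0 a0 g0 dy.
rewrite RintegralD// RintegralZl// Rintegral_powkM// mulrDr.
rewrite -[X in _ + X]/(RLk _ _ _) (RLk_semigroup T g'0 a0 g0 dy) -zE y0 addr0.
(* The exponents [1 - gamma] and [gamma] add up to 1, so the power becomes the constant 1 and
   [Gamma 1 = 1] leaves only cancelling factors. *)
rewrite /Beta subrK Gamma1 divr1 powk1 T0 mulr1; field.
by rewrite !gt_eqF ?Gamma_gt0.
Qed.
End FixedPoint.

(** * The equivalence with the boundary value problem *)

Theorem theorem3p2 (R : realType) (d : nat) (T alpha beta : R)
    (x0 : 'cV[R]_d) (D : set 'cV[R]_d) (f : R -> 'cV[R]_d -> 'cV[R]_d)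
    (m : 'cV[R]_d) (K : 'M[R]_d) (x : R -> 'cV[R]_d) :
  let gamma := hgamma alpha beta in
  let X_D := X_ gamma T D in
  0 < T -> 0 < alpha < 1 -> 0 <= beta <= 1 ->
  closed D -> bounded_set D ->
  D ((Gamma gamma)^-1 *: x0) ->
  [set u | vwC gamma T u /\
           mx_le (vwCnorm gamma T (u \- xinit alpha beta x0))
                 (Xi alpha beta T *: m)] `<=` X_D ->
  (forall u, X_D u -> vwC gamma T (fun t => f t (u t))) ->
  mx_le 0 m ->
  (forall u, X_D u -> mx_le (vwCnorm gamma T (fun t => f t (u t))) m) ->
  mx_le 0 K ->
  (forall u v t, X_D u -> X_D v -> 0 < t <= T ->
     mx_le (mx_abs (f t (u t) - f t (v t))) (K *m mx_abs (u t - v t))) ->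
  spectral_radius (Xi alpha beta T *: K) < 1 ->
  cvg_wC gamma T (xseq alpha beta T f x0) x ->
  solves_ivp alpha beta T f (Delta alpha beta T f x) x0 x ->
  solves_bvp alpha beta T f x <-> Delta alpha beta T f x = 0.
Proof.
move=> gamma X_D T0 a01 b01 cD _ x0D ballX fwC _ fm K0 fK _ cx [[wx hx eqx] x0x].
split=> [[[_ _ eqx'] _]|D0].
  (* The midpoint is a sample point of [(0, T)]: there [f + 0] and [f + Delta] both equal the Hilfer
     derivative. *)
  have T2 : 0 < T / 2 < T by apply/andP; split; lra.
  have := eqx _ T2; rewrite eqx'// => /esym/addrI.
  exact.
rewrite D0 in eqx; split; first by split.
have xX := limit_X T0 a01 b01 cD x0D ballX fwC fm cx.
have xfix := limit_fixed_point T0 a01 b01 cD x0D ballX fwC fm fK K0 cx.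
(* The right limit at 0 is [x0] by assumption, so only the value at [T] has to be identified with
   [x0]. *)
move=> i; rewrite mxE; move: (x0x i); congr (_ --> _).
rewrite (RL0_fixed_point T0 a01 b01 (fwC _ xX i) xfix)//.
have z0 := hzeta_gt0 a01 b01.
(* [Delta] is a nonzero multiple of [I^zeta F] at [T], so its vanishing is that of the integral. *)
have /matrixP/(_ i 0) := D0; rewrite !mxE => /eqP.
rewrite oppr_eq0 mulf_eq0 => /orP[|/eqP//].
by rewrite gt_eqF// mulr_gt0 ?powR_gt0// Gamma_gt0// addr_gt0.
Qed.
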